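(* Let $M\ge 2$ be an integer, $h=\frac1M$, and let $\nu,\lambda\in\mathbb{R}$ with $\nu>0$ and $\lambda\ge 0$. Define the real matrices $$A_{1,1}=(2\nu+\lambda)\,I_M\otimes (D_M^TD_M)+\nu\,(D_{M+1}^T D^{\ast}_{M+1})\otimes I_{M-1},$$ $$A_{1,2}=(\nu+\lambda)\,D_M\otimes D_M^T,\qquad A_{2,1}=(\nu+\lambda)\,D_M^T\otimes D_M,$$ $$A_{2,2}=(2\nu+\lambda)\,(D_M^TD_M)\otimes I_M+\nu\, I_{M-1}\otimes (D_{M+1}^T D^{\ast}_{M+1}),$$ each of size $M(M-1)\times M(M-1)$. Then the block matrix $$A=\begin{bmatrix}A_{1,1}&A_{1,2}\\ A_{2,1}&A_{2,2}\end{bmatrix}\in\mathbb{R}^{2M(M-1)\times 2M(M-1)}$$ is symmetric and positive definite.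
   Context: $I_n$ is the $n\times n$ identity matrix and $\otimes$ is the Kronecker product of matrices. The step size $h=1/M$ is fixed and is used in all the matrices below, including those with index $M+1$. For $n\ge 2$, $D_n\in\mathbb{R}^{n\times(n-1)}$ is the matrix $$D_n=\frac1h\begin{bmatrix}1&0&0&\dots&0\\-1&1&0&\dots&0\\ \cdots&\cdots&\cdots&\cdots&\cdots\\0&\dots&0&-1&1\\0&\dots&0&0&-1\end{bmatrix},$$ i.e. $(D_n)_{k,k}=\frac1h$ and $(D_n)_{k+1,k}=-\frac1h$ for $k=1,\dots,n-1$, all other entries being zero. For $n\ge 3$, $D_n^{\ast}\in\mathbb{R}^{n\times(n-1)}$ is the matrix $$D_n^{\ast}=\frac1h\begin{bmatrix}2&0&0&\dots&0\\-1&1&0&\dots&0\\ \cdots&\cdots&\cdots&\cdots&\cdots\\0&\dots&0&-1&1\\0&\dots&0&0&-2\end{bmatrix},$$ i.e. $D_n^{\ast}$ coincides with $D_n$ except that its $(1,1)$ entry is $\frac2h$ and its $(n,n-1)$ entry is $-\frac2h$ (here $\ast$ is just part of the name of the matrix, not an adjoint). Thus $D_M^TD_M$ is of size $(M-1)\times(M-1)$ and $D_{M+1}^TD_{M+1}^{\ast}$ is of size $M\times M$. *)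

(* Defs.v *)
From mathcomp Require Import all_boot all_order all_algebra.
From mathcomp Require Import reals.
From mathcomp.real_closed Require Import mxtens.

Set Implicit Arguments.
Unset Strict Implicit.
Unset Printing Implicit Defensive.

Import Order.TTheory GRing.Theory Num.Theory.
Local Open Scope ring_scope.

(* Indices start at 0, so row i and column j here are row i + 1 and column
   j + 1 in one-based notation. The step h is independent of the size n. *)
Definition Dmx (R : realType) (h : R) (n : nat) : 'M[R]_(n, n.-1) :=
  \matrix_(i < n, j < n.-1)
    (if i == j :> nat then h^-1
     else if i == j.+1 :> nat then - h^-1
     else 0).

(* Meant for n >= 3 only: for n = 2 both modified entries lie in the single
   column. *)
Definition Dstar (R : realType) (h : R) (n : nat) : 'M[R]_(n, n.-1) :=
  \matrix_(i < n, j < n.-1)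
    (if (i == 0 :> nat) && (j == 0 :> nat) then 2 / h
     else if (i == n.-1 :> nat) && (j == n.-2 :> nat) then - (2 / h)
     else Dmx h n i j).

Definition posdefmx (R : realType) (n : nat) (A : 'M[R]_n) : Prop :=
  forall x : 'cV[R]_n, x != 0 -> 0 < (x^T *m A *m x) 0 0.

(* Main.v *)
Require Import Defs.
From mathcomp Require Import all_boot all_order all_algebra.
From mathcomp Require Import reals.
From mathcomp.real_closed Require Import mxtens.
From mathcomp Require Import ring.

Set Implicit Arguments.
Unset Strict Implicit.
Unset Printing Implicit Defensive.

Import Order.TTheory GRing.Theory Num.Theory.
Local Open Scope ring_scope.

(** Write [G^T G] for the Gram matrix of [G]. The matrix [A] is a sum of Gram
    matrices with nonnegative weights. Since [D_M (x) D_M^T] equals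
    [(I (x) D_M)^T (D_M (x) I)], completing the square gives
    [nu P^T P + (nu + lambda) K^T K] with [P = diag(I (x) D_M, D_M (x) I)] and
    [K = [I (x) D_M, D_M (x) I]], plus the terms coming from
    [D_{M+1}^T D*_{M+1}], which is itself [D_{M+1}^T D_{M+1}] plus [h^-2] at
    both ends of the diagonal. Definiteness comes from [P] alone: [D_M] has a
    left inverse (summation), hence so has [P]. *)

Section Gram.
Variable R : realType.

Definition gram (m n : nat) (G : 'M[R]_(m, n)) : 'M[R]_n := G^T *m G.

Lemma gram_sym m n (G : 'M[R]_(m, n)) : (gram G)^T = gram G.
Proof. by rewrite /gram trmx_mul trmxK. Qed.

Lemma gram_quadE m n (G : 'M[R]_(m, n)) (x : 'cV_n) :
  (x^T *m gram G *m x) 0 0 = \sum_i (G *m x) i 0 ^+ 2.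
Proof.
rewrite /gram !mulmxA -trmx_mul -mulmxA mxE.
by apply: eq_bigr => i _; rewrite mxE expr2.
Qed.

Lemma gram_quad_ge0 m n (G : 'M[R]_(m, n)) (x : 'cV_n) :
  0 <= (x^T *m gram G *m x) 0 0.
Proof. by rewrite gram_quadE sumr_ge0 // => i _; rewrite sqr_ge0. Qed.

(** The quadratic form is a sum of squares, so its vanishing forces [G *m x = 0]; applying [L] then
    gives [x = 0]. *)
Lemma gram_posdef m n (G : 'M[R]_(m, n)) (L : 'M[R]_(n, m)) :
  L *m G = 1%:M -> posdefmx (gram G).
Proof.
move=> LG x x0; rewrite lt_def gram_quad_ge0 andbT.
apply: contra x0; rewrite gram_quadE psumr_eq0; last by move=> i _; apply: sqr_ge0.
move=> /allP Gx0; rewrite -[x]mul1mx -LG -mulmxA.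
suff -> : G *m x = 0 by rewrite mulmx0.
apply/colP => i; rewrite [RHS]mxE; apply/eqP.
by rewrite -sqrf_eq0; apply: Gx0; rewrite mem_index_enum.
Qed.

Lemma gram_block_diag m n p q (G : 'M[R]_(m, n)) (H : 'M[R]_(p, q)) :
  gram (block_mx G 0 0 H) = block_mx (gram G) 0 0 (gram H).
Proof.
by rewrite /gram tr_block_mx !trmx0 mulmx_block !(mulmx0, mul0mx, addr0, add0r).
Qed.

Lemma gram_row_mx m n p (G : 'M[R]_(m, n)) (H : 'M[R]_(m, p)) :
  gram (row_mx G H) = block_mx (gram G) (G^T *m H) (H^T *m G) (gram H).
Proof. by rewrite /gram tr_row_mx mul_col_row. Qed.

Lemma tens_gram_1mx m n k (G : 'M[R]_(m, n)) :
  gram G *t (1%:M : 'M[R]_k) = gram (G *t (1%:M : 'M[R]_k)).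
Proof. by rewrite /gram trmx_tens tensmx_mul trmx1 mul1mx. Qed.

Lemma tens_1mx_gram m n k (G : 'M[R]_(m, n)) :
  (1%:M : 'M[R]_k) *t gram G = gram ((1%:M : 'M[R]_k) *t G).
Proof. by rewrite /gram trmx_tens tensmx_mul trmx1 mul1mx. Qed.

End Gram.

Section Tens.
Variable R : comPzRingType.

Lemma tensmxDl m n p q (A B : 'M[R]_(m, n)) (C : 'M[R]_(p, q)) :
  (A + B) *t C = A *t C + B *t C.
Proof. by apply/matrixP => i j; rewrite !mxE mulrDl. Qed.

Lemma tensmxDr m n p q (A : 'M[R]_(m, n)) (B C : 'M[R]_(p, q)) :
  A *t (B + C) = A *t B + A *t C.
Proof. by apply/matrixP => i j; rewrite !mxE mulrDr. Qed.

Lemma tens1mx1 m n : (1%:M : 'M[R]_m) *t (1%:M : 'M[R]_n) = 1%:M.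
Proof.
apply/matrixP => i j.
case: (mxtens_indexP i) => i1 i2; case: (mxtens_indexP j) => j1 j2.
rewrite tensmxE !mxE (can_eq (@mxtens_indexK m n)) xpair_eqE.
by case: eqP; case: eqP; rewrite ?mulr1 ?mulr0.
Qed.

End Tens.

Section DifferenceMatrices.
Variables (R : realType) (h : R).

Definition Dmx_linv (n : nat) : 'M[R]_(n.-1, n) :=
  \matrix_(i, j) (if (j <= i)%N then h else 0).

(** Row [i] of [Dmx_linv] sums the entries up to [i] and scales by [h]. Column [j] of [Dmx] has its
    only nonzero entries, opposite to each other, in rows [j] and [j.+1]: the sum contains neither
    if [i < j], both if [j < i], and just the first if [i = j]. *)
Lemma Dmx_linvK (n : nat) : h != 0 -> Dmx_linv n *m Dmx h n = 1%:M.
Proof.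
case: n => [|n] h0; apply/matrixP => i j; first by case: i.
rewrite !mxE.
have jn : (j < n.+1)%N by apply: leq_trans (ltn_ord j) _.
have jn1 : (j.+1 < n.+1)%N by rewrite ltnS.
rewrite (bigD1 (Ordinal jn)) // (bigD1 (Ordinal jn1)) /=; last first.
  by rewrite -val_eqE /= neq_ltn ltnSn orbT.
rewrite big1 => [|k /andP[]]; last first.
  by rewrite -!val_eqE /= => kj kj1; rewrite !mxE (negbTE kj) (negbTE kj1) mulr0.
rewrite !mxE /= eqxx (gtn_eqF (ltnSn j)) eqxx -val_eqE /=.
by case: (ltngtP j i) => ij; rewrite ?mul0r ?mulrN ?divff // ?addr0 ?subrr.
Qed.

Lemma Dmx_tr_delta0 (n : nat) :
  (Dmx h n.+3)^T *m (delta_mx ord0 ord0 : 'M_(n.+3, n.+2)) =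
  h^-1 *: delta_mx ord0 ord0.
Proof.
apply/matrixP => i j; rewrite !mxE (bigD1 ord0) //= big1 => [|k k0]; last first.
  by rewrite !mxE (negbTE k0) mulr0.
rewrite !mxE addr0 -!val_eqE /=.
by case: (i : nat) => [|?] /=; rewrite ?mul0r ?mulr0.
Qed.

(** The last row of [Dmx] has the single nonzero entry [- h^-1]. This sign cancels the one in
    [DstarE], so both corners contribute positively to [Dmx_tr_Dstar]. *)
Lemma Dmx_tr_delta_max (n : nat) :
  (Dmx h n.+3)^T *m (delta_mx ord_max ord_max : 'M_(n.+3, n.+2)) =
  - (h^-1 *: delta_mx ord_max ord_max).
Proof.
apply/matrixP => i j; rewrite !mxE (bigD1 ord_max) //= big1 => [|k k0]; last first.
  by rewrite !mxE (negbTE k0) mulr0.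
rewrite !mxE eqxx addr0 -!val_eqE /= (gtn_eqF (ltn_ord i)) eqSS eq_sym.
by case: eqP => _ /=; rewrite ?mulNr ?mul0r ?mulr0 ?oppr0.
Qed.

Lemma DstarE (n : nat) :
  Dstar h n.+3 =
  Dmx h n.+3 + h^-1 *: (delta_mx ord0 ord0 - delta_mx ord_max ord_max).
Proof.
apply/matrixP => i j; rewrite !mxE -!val_eqE /=.
case: (altP andP) => [[/eqP-> /eqP->]|_] /=; first by ring.
case: (altP andP) => [[/eqP-> /eqP->]|_] /=.
  by rewrite (gtn_eqF (ltnSn _)) eqxx; ring.
by rewrite subrr mulr0 addr0.
Qed.

(** The corner correction is [h^-2] times a diagonal projection. A projection is its own Gram
    matrix, so this part is a Gram matrix too. *)
Lemma Dmx_tr_Dstar (n : nat) :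
  (Dmx h n.+3)^T *m Dstar h n.+3 =
  gram (Dmx h n.+3) +
  gram (h^-1 *: (delta_mx ord0 ord0 + delta_mx ord_max ord_max : 'M_n.+2)).
Proof.
rewrite DstarE mulmxDr -scalemxAr mulmxBr Dmx_tr_delta0 Dmx_tr_delta_max opprK; congr (_ + _).
rewrite /gram [X in X *m _]linearZ [X in _ *: X *m _]linearD /= !trmx_delta -scalemxAl -scalemxAr.
(* The cross products vanish because [ord0] and [ord_max] differ in ['I_n.+2]. *)
rewrite mulmxDl !mulmxDr !mul_delta_mx !mul_delta_mx_0 // addr0 add0r.
by rewrite !scalerDr.
Qed.

End DifferenceMatrices.

Theorem proposition1 (R : realType) (M : nat) (nu lambda : R) :
  (2 <= M)%N -> 0 < nu -> 0 <= lambda ->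
  let h : R := 1 / M%:R in
  let D := Dmx h in
  let Ds := Dstar h in
  let A11 : 'M[R]_(M * M.-1) :=
    (2 * nu + lambda) *: ((1%:M : 'M[R]_M) *t ((D M)^T *m D M))
    + nu *: (((D M.+1)^T *m Ds M.+1) *t (1%:M : 'M[R]_(M.-1))) in
  let A12 : 'M[R]_(M * M.-1, M.-1 * M) :=
    (nu + lambda) *: (D M *t (D M)^T) in
  let A21 : 'M[R]_(M.-1 * M, M * M.-1) :=
    (nu + lambda) *: ((D M)^T *t D M) in
  let A22 : 'M[R]_(M.-1 * M) :=
    (2 * nu + lambda) *: (((D M)^T *m D M) *t (1%:M : 'M[R]_M))
    + nu *: ((1%:M : 'M[R]_(M.-1)) *t ((D M.+1)^T *m Ds M.+1)) in
  let A : 'M[R]_(M * M.-1 + M.-1 * M) := block_mx A11 A12 A21 A22 in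
  A \is symmetricmx /\ posdefmx A.
Proof.
case: M => [|[|n]] // _ nu0 la0 h D Ds.
have h0 : h != 0 by rewrite /h mul1r invr_eq0 pnatr_eq0.
set M := n.+2 => A11 A12 A21 A22 A.
(* [gram F] is the correction term of [Dmx_tr_Dstar] for size [M.+1]. *)
pose F : 'M[R]_M := h^-1 *: (delta_mx ord0 ord0 + delta_mx ord_max ord_max).
pose I k : 'M[R]_k := 1%:M.
pose P := block_mx (I M *t D M) 0 0 (D M *t I M).
pose K := row_mx (I M *t D M) (D M *t I M).
have AE : A = nu *: gram P + (nu + lambda) *: gram K
            + nu *: (gram (block_mx (D M.+1 *t I M.-1) 0 0 (I M.-1 *t D M.+1))
                     + gram (block_mx (F *t I M.-1) 0 0 (I M.-1 *t F))).
  rewrite !gram_block_diag gram_row_mx !add_block_mx !scale_block_mx.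
  rewrite !add_block_mx !(scaler0, addr0, add0r) !trmx_tens !tensmx_mul.
  rewrite !trmx1 !(mul1mx, mulmx1) -!tens_gram_1mx -!tens_1mx_gram.
  rewrite -!tensmxDl -!tensmxDr -Dmx_tr_Dstar -!scalerDl.
  (* On the diagonal blocks, [P] and [K] contribute [nu] and [nu + lambda], which add up to
     [2 * nu + lambda]. *)
  by rewrite addrA -mulr2n -mulr_natl.
split.
  (* [symmetricmx] is the sesquilinear notion with sign [(-1) ^+ 0] and identity conjugation, both
     removed here. *)
  apply/eqP; rewrite expr0 scale1r map_mx_id // AE.
  by rewrite !(linearD, linearZ) /= !gram_sym.
have LP : block_mx (I M *t Dmx_linv h M) 0 0 (Dmx_linv h M *t I M) *m P = 1%:M.
  rewrite mulmx_block !(mulmx0, mul0mx, addr0, add0r) !tensmx_mul.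
  by rewrite !mul1mx !Dmx_linvK // !tens1mx1 -scalar_mx_block.
move=> x x0; rewrite AE; pose q B : R := (x^T *m B *m x) 0 0.
have qD B C : q (B + C) = q B + q C by rewrite /q mulmxDr mulmxDl mxE.
have qZ c B : q (c *: B) = c * q B by rewrite /q -scalemxAr -scalemxAl mxE.
(* The form [q] is linear in the matrix: the [gram P] term is strictly positive and the others are
   nonnegative. *)
rewrite -/(q _) !(qD, qZ) -addrA ltr_pwDl //.
  by rewrite mulr_gt0 //; apply: gram_posdef LP x x0.
by rewrite addr_ge0 ?mulr_ge0 ?addr_ge0 ?gram_quad_ge0 // ltW.
Qed.
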